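(* Let $K$ be a field of characteristic $2$ and let $V$ be a vector space of finite dimension $n$ over $K$. Let $\mathcal{M}$ be a subspace of $\mathrm{Symm}(V)$ and suppose that the rank of each non-zero element of $\mathcal{M}$ is either $r$ or $n$, where $0<r<n$, $r$ is odd and $n$ is even. Then $\dim \mathcal{M}\leq n+r$.
   Context: $\mathrm{Symm}(V)$ denotes the $K$-vector space of symmetric bilinear forms $V\times V\to K$. The rank of a form $f$ is $\dim V-\dim \mathrm{rad}\,f$, where $\mathrm{rad}\,f=\{u\in V: f(u,v)=0 \text{ for all } v\in V\}$. *)

(* Defs.v *)
From HB Require Import structures.
From mathcomp Require Import all_boot all_order all_algebra.
Set Implicit Arguments.
Unset Strict Implicit.
Unset Printing Implicit Defensive.
Import GRing.Theory.
Local Open Scope ring_scope.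

(* A bilinear form f on V is encoded in curried form, as the linear map        *)
(* u |-> f(u, _) from V to its dual: f u v is the value f(u, v), and the type  *)
(* of forms is itself a finite-dimensional space under pointwise operations.   *)
(* The structures {bilinear _ -> _ -> _} and {symmetric _} of sesquilinear.v   *)
(* have no vectType instance, hence no notion of subspace or dimension.        *)
Notation bilform V := 'Hom(V, 'Hom(V, _^o)).

Section Forms.
Variables (K : fieldType) (V : vectType K).
Implicit Types f : 'Hom(V, 'Hom(V, K^o)).

(* linfun g agrees with g only when g is linear, which is the case of the uses *)
(* of linfun here and in Symm: see form_swapE and SymmP.                       *)
Definition form_swap f : 'Hom(V, 'Hom(V, K^o)) :=
  linfun (fun u => linfun (fun v => f v u : K^o)).

Lemma form_swapE f u v : form_swap f u v = f v u.
Proof.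
pose row_of u : V -> K^o := fun v => f v u.
have row_lin w : linear (row_of w).
  by move=> a x y; rewrite /row_of linearP add_lfunE scale_lfunE.
pose rowL w : {linear V -> K^o} :=
  HB.pack (row_of w) (GRing.isLinear.Build _ _ _ _ _ (row_lin w)).
have rowE w x : linfun (row_of w) x = f x w by rewrite (lfunE (rowL w)).
have swap_lin : linear (fun w => linfun (row_of w)).
  by move=> a x y; apply/lfunP => z;
     rewrite add_lfunE scale_lfunE !rowE linearP.
pose swapL : {linear V -> 'Hom(V, K^o)} :=
  HB.pack (fun w => linfun (row_of w))
    (GRing.isLinear.Build _ _ _ _ _ swap_lin).
by rewrite /form_swap (lfunE swapL) rowE.
Qed.

Definition Symm : {vspace 'Hom(V, 'Hom(V, K^o))} :=
  lker (linfun (fun f => f - form_swap f)).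

Lemma SymmP f : reflect (forall u v : V, f u v = f v u) (f \in Symm).
Proof.
have skew_lin : linear (fun f => f - form_swap f).
  move=> a g h; apply/lfunP => u; apply/lfunP => v.
  rewrite !(add_lfunE, opp_lfunE, scale_lfunE, form_swapE).
  by rewrite scalerBr opprD addrACA.
pose skewL : {linear 'Hom(V, 'Hom(V, K^o)) -> 'Hom(V, 'Hom(V, K^o))} :=
  HB.pack (fun f => f - form_swap f)
    (GRing.isLinear.Build _ _ _ _ _ skew_lin).
rewrite memv_ker (lfunE skewL) subr_eq0.
apply: (iffP eqP) => [fE u v | fC]; first by rewrite {1}fE form_swapE.
by apply/lfunP => u; apply/lfunP => v; rewrite form_swapE.
Qed.

Definition radical f : {vspace V} := lker f.

Lemma radicalP f (u : V) :
  reflect (forall v : V, f u v = 0) (u \in radical f).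
Proof.
rewrite memv_ker; apply: (iffP eqP) => [-> v | fu0]; first by rewrite zero_lfunE.
by apply/lfunP => v; rewrite zero_lfunE.
Qed.

Definition form_rank f : nat := (\dim {:V} - \dim (radical f))%N.

End Forms.

Arguments Symm {K} V.

(* Main.v *)
Require Import Defs.
From HB Require Import structures.
From mathcomp Require Import all_boot all_order all_fingroup all_algebra.
From mathcomp Require Import finfield ring zify.
From Stdlib Require Import Classical_Prop.
Set Implicit Arguments.
Unset Strict Implicit.
Unset Printing Implicit Defensive.
Import GRing.Theory Num.Theory.
Local Open Scope ring_scope.

(** Fix a nonzero vector u. Evaluation f |-> f(u, _) sends M to the dual of V,
    of dimension n, and the forms in its kernel N have u in their radical, so
    that all nonzero elements of N have the odd rank r. It remains to show that
    a space N of symmetric forms of constant odd rank r has dimension at most r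
    ([constant_odd_rank_dim_le]).

    Two features of characteristic 2 are used. The diagonal u |-> f(u, u) of a
    symmetric form is additive and satisfies f(au, au) = a^2 f(u, u), so it is
    determined by its values on a basis ([diagonal_sum]). And a symmetric form
    with zero diagonal has even rank ([alternating_rank_even]), since an
    alternating matrix of odd size is singular.

    If K is infinite, take a nonzero f in N. As f + t g has rank at most r for
    all t, a determinant that is polynomial in t vanishes, which forces the
    diagonal of every g in N to vanish on the radical of f
    ([diagonal_radical_eq0]). This diagonal is then determined by its values on
    a basis of a complement of the radical, which has r elements. A form in N
    with zero diagonal has even rank, hence is zero, so dim N <= r.

    If K is finite of order q, that argument fails for small q, and a character
    sum replaces it. The elements x^2 + x form an additive subgroup of index 2
    in K; let chi be the character with values 1 on it and -1 off it, and
    choose d with chi(d) = -1. For a symmetric form f put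
      S(f) = sum over u, v in V of chi(f(u, u) + f(u, v) + d f(v, v)).
    Three facts give the bound. The sum of the S(f) for f in N is nonnegative,
    since for fixed u and v it is the sum of a character over a group
    ([sum_hermitian_sum_ge0]); S(0) = q^(2n); and S(f) = - q^(2n - r) when f
    has odd rank r ([hermitian_sum_odd]). Hence (q^(dim N) - 1) q^(2n - r) is
    at most q^(2n), that is, q^(dim N) - 1 <= q^r, and dim N <= r. *)

(** * Determinants of alternating matrices in characteristic 2 *)

(** The terms at i and h i are equal, so they cancel unless i = h i. *)
Lemma sum_involution_pchar2 (R : nzRingType) (I : finType) (h : I -> I)
    (F : I -> R) :
  2%N \in [pchar R] -> involutive h -> F \o h =1 F ->
  \sum_i F i = \sum_(i | h i == i) F i.
Proof.
move=> char2 hK Fh; pose above i := (enum_rank i < enum_rank (h i))%N.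
rewrite (bigID (fun i => h i == i)) /= [X in _ + X](bigID above) /=.
rewrite -[RHS]addr0; congr (_ + _).
apply: etrans (addrr_pchar2 char2 (\sum_(i | (h i != i) && above i) F i)).
congr (_ + _).
rewrite (reindex_inj (inv_inj hK)) /=; apply: eq_big => [i | i _].
  rewrite /above hK (eq_sym i); have [// | hi_neq /=] := eqVneq (h i) i.
  rewrite -leqNgt leq_eqVlt; case: eqP => //= /val_inj /enum_rank_inj ih.
  by rewrite -ih eqxx in hi_neq.
exact: Fh.
Qed.

(** In the Leibniz formula s and s^-1 have equal terms, so only involutions
    matter. An involution of a set of odd size has a fixed point (the same
    cancellation, applied to the sum of n ones), and its term contains a
    diagonal entry. *)
Lemma det_alternating_odd (K : fieldType) (n : nat) (A : 'M[K]_n) :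
  2%N \in [pchar K] -> A^T = A -> (forall i, A i i = 0) -> odd n -> \det A = 0.
Proof.
move=> char2 symA A0 n_odd.
have n1 : n%:R = 1 :> K.
  rewrite -(odd_double_half n) n_odd natrD -muln2 natrM (pcharf0 char2).
  by rewrite mulr0 addr0.
rewrite /determinant.
rewrite (@sum_involution_pchar2 K _ (fun s : 'S_n => (s^-1)%g)) //=.
- rewrite big1 // => s /eqP sV.
  have ss : involutive s by move=> i; rewrite -{1}sV permK.
  have [i /eqP si | no_fix] := pickP (fun i => s i == i).
    by rewrite (bigD1 i) //= si A0 mul0r mulr0.
  have := sum_involution_pchar2 char2 ss (frefl (fun=> 1 : K)).
  by rewrite [RHS]big_pred0 // sumr_const card_ord n1 => /eqP; rewrite oner_eq0.
- exact: invgK.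
move=> s /=; rewrite odd_permV; congr (_ * _).
rewrite (reindex_inj (@perm_inj _ s)); apply: eq_bigr => i _.
by rewrite permK -[in LHS]symA mxE.
Qed.

(** * Gram matrices and rank *)

Section Gram.
Variables (K : fieldType) (V : vectType K).
Implicit Types (f g : bilform V).

Definition gram f k (X : 'I_k -> V) : 'M[K]_k := \matrix_(i, j) f (X i) (X j).

Lemma form_rank_limg f : form_rank f = \dim (limg f).
Proof. by rewrite /form_rank -(limg_ker_dim f fullv) capfv addKn. Qed.

Lemma form_rank0 : form_rank (0 : bilform V) = 0%N.
Proof.
rewrite /form_rank (_ : radical 0 = fullv) ?subnn //.
by apply/vspaceP => u; rewrite memvf; apply/radicalP => v; rewrite !zero_lfunE.
Qed.

Lemma gram_mul f k (X : 'I_k -> V) (a : 'rV_k) (j : 'I_k) :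
  f (\sum_i a 0 i *: X i) (X j) = (a *m gram f X) 0 j.
Proof.
rewrite mxE linear_sum sum_lfunE; apply: eq_bigr => i _.
by rewrite linearZ scale_lfunE !mxE.
Qed.

(** The functionals f(X i, _) are linearly independent: evaluating a relation
    between them at the X j gives a row vector killed by the Gram matrix. *)
Lemma gram_unit_leq_rank f k (X : 'I_k -> V) :
  gram f X \in unitmx -> (k <= form_rank f)%N.
Proof.
move=> unitG; rewrite form_rank_limg; pose Y := [tuple f (X i) | i < k].
have freeY : free Y.
  apply/freeP => a a0 i; pose b := \row_i a i.
  have b0 : b *m gram f X = 0.
    apply/rowP => j; rewrite -gram_mul mxE.
    have -> : f (\sum_l b 0 l *: X l) = 0; last by rewrite zero_lfunE.
    rewrite -{}a0 linear_sum; apply: eq_bigr => l _.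
    by rewrite linearZ mxE nth_mktuple.
  by have := congr1 (fun c => c *m invmx (gram f X)) b0;
     rewrite mulmxK // mul0mx => /rowP/(_ i); rewrite !mxE.
rewrite -[k](size_tuple Y) -(eqnP freeY).
by apply/dimvS/span_subvP => _ /mapP[i _ ->]; rewrite memv_img ?memvf.
Qed.

Definition corad_basis f (i : 'I_(\dim (radical f)^C)) : V :=
  (vbasis (radical f)^C)`_i.

Lemma dim_corad f : \dim (radical f)^C = form_rank f.
Proof. exact: dimv_compl. Qed.

Lemma corad_decomp f (u : V) :
  exists (a : 'rV_(\dim (radical f)^C)) rho, rho \in radical f /\
    u = \sum_i a 0 i *: corad_basis i + rho.
Proof.
have : u \in (radical f + (radical f)^C)%VS by rewrite addv_complf memvf.
case/memv_addP => rho rad_rho [c Cc ->].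
exists (\row_i coord (vbasis (radical f)^C) i c), rho; split=> //.
rewrite addrC {1}(coord_vbasis Cc); congr (_ + _).
by apply: eq_bigr => i _; rewrite mxE.
Qed.

(** The form f is nondegenerate on a complement of its radical. *)
Lemma gram_corad_unit f : f \in Symm V -> gram f (@corad_basis f) \in unitmx.
Proof.
move=> /SymmP symf; rewrite -row_free_unit -kermx_eq0; apply/rowV0P => a.
move/sub_kermxP => aG0; set c := \sum_i a 0 i *: @corad_basis f i.
have Cc : c \in (radical f)^C%VS.
  apply: memv_suml => i _.
  by rewrite memvZ // vbasis_mem // mem_nth ?size_tuple.
have Rc : c \in radical f.
  apply/radicalP => v; have [b [rho [/radicalP rho0 ->]]] := corad_decomp f v.
  rewrite linearD /= (symf c rho) rho0 addr0 linear_sum big1 // => j _.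
  by rewrite linearZ /= gram_mul aG0 mxE scaler0.
have c0 : c = 0.
  by apply/eqP; rewrite -memv0 -(capv_compl (radical f)) memv_cap Rc.
have /freeP fr := basis_free (vbasisP (radical f)^C).
by apply/rowP => i; rewrite (fr (a 0) c0) mxE.
Qed.

End Gram.

(** * Diagonals of symmetric forms in characteristic 2 *)

Section CharTwoForms.
Variables (K : fieldType) (V : vectType K).
Hypothesis char2 : 2%N \in [pchar K].
Implicit Types (f g : bilform V).

Lemma alternating_rank_even f :
  f \in Symm V -> (forall u, f u u = 0) -> ~~ odd (form_rank f).
Proof.
move=> symf altf; apply/negP; rewrite -dim_corad => odd_r.
have := gram_corad_unit symf; rewrite unitmxE det_alternating_odd ?unitr0 //.
  by apply/matrixP => i j; rewrite !mxE; apply/SymmP.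
by move=> i; rewrite mxE altf.
Qed.

Lemma diagonalD f (u v : V) : f \in Symm V -> f (u + v) (u + v) = f u u + f v v.
Proof.
move=> /SymmP symf; rewrite !linearD /= !add_lfunE (symf v u) addrA.
by rewrite -(addrA (f u u)) addrr_pchar2 // addr0.
Qed.

Lemma diagonal_sum f k (X : 'I_k -> V) (a : 'rV_k) :
  f \in Symm V ->
  f (\sum_i a 0 i *: X i) (\sum_i a 0 i *: X i)
    = \sum_i a 0 i ^+ 2 * f (X i) (X i).
Proof.
move=> symf; rewrite (big_morph (fun u => f u u) (id1 := 0) (op1 := +%R)).
- by apply: eq_bigr => i _; rewrite !linearZ /= scale_lfunE scalerA.
- by move=> u v; exact: diagonalD.
- by rewrite linear0.
Qed.

End CharTwoForms.

(** * Constant odd rank over an infinite field *)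

Section InfiniteField.
Variables (K : fieldType) (V : vectType K).
Hypothesis K_infinite : forall s : seq K, exists x, x \notin s.
Implicit Types (f g : bilform V).

Lemma poly_vanishing_eq0 (p : {poly K}) :
  (forall t, t != 0 -> p.[t] = 0) -> p = 0.
Proof.
move=> p0; have big k : exists2 s : seq K, uniq s & size s = k.
  elim: k => [|k [s uniq_s <-]]; first by exists [::].
  by have [x x_s] := K_infinite s; exists (x :: s) => //=; rewrite x_s.
have [s uniq_s sz_s] := big (size (p * 'X)).
apply: contraTeq isT => p_neq0.
have pX0 : p * 'X != 0 by rewrite mulf_neq0 ?polyX_eq0.
suff /(max_poly_roots pX0)/(_ uniq_s) : all (root (p * 'X)) s.
  by rewrite sz_s ltnn.
apply/allP => t _; rewrite rootE hornerM hornerX.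
by have [->|/p0->] := eqVneq t 0; rewrite ?mulr0 ?mul0r.
Qed.

(** On a basis X of a complement of rad f, followed by u in rad f, the form
    f + t g has the Gram matrix with blocks Gf + t Gg, t c^T, t c, t g(u, u),
    where Gf and Gg are the Gram matrices of f and g on X. It has one row more
    than the rank of f, so it is singular. Dividing its last row by t gives a
    matrix whose determinant, a polynomial in t, vanishes for all nonzero t,
    hence also for t = 0, where its value is det Gf * g(u, u). *)
Lemma diagonal_radical_eq0 f g (u : V) :
  f \in Symm V -> g \in Symm V ->
  (forall t, (form_rank (f + t *: g)%R <= form_rank f)%N) ->
  u \in radical f -> g u u = 0.
Proof.
move=> symf symg rank_le rad_u; set k := \dim (radical f)^C.
pose X := @corad_basis _ _ f.
pose c : 'rV[K]_k := \row_i g u (X i).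
(* B is used twice: over K, and over {poly K} with t the indeterminate.       *)
pose B (R : comNzRingType) (phi : K -> R) t : 'M[R]_(k + 1) :=
  block_mx (map_mx phi (gram f X) + t *: map_mx phi (gram g X))
           (t *: (map_mx phi c)^T) (map_mx phi c) (phi (g u u))%:M.
have det_unscaled t : t != 0 -> \det (B K id t) = 0.
  move=> t0; pose Y (i : 'I_(k + 1)) := if split i is inl j then X j else u.
  have gramE : gram (f + t *: g) Y = block_mx 1%:M 0 0 t%:M *m B K id t.
    rewrite mulmx_block !mul0mx !mul1mx !addr0 !add0r !mul_scalar_mx.
    have /radicalP fu := rad_u; have /SymmP fC := symf; have /SymmP gC := symg.
    rewrite -[LHS]submxK; congr block_mx; apply/matrixP => i j;
      rewrite !mxE /Y ?(unsplitK (inl _)) ?(unsplitK (inr _));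
      rewrite !add_lfunE !scale_lfunE ?fu ?(fC _ u) ?fu ?add0r ?(gC _ u) //.
    by rewrite !ord1.
  have : ~~ (gram (f + t *: g) Y \in unitmx).
    apply/negP => /gram_unit_leq_rank/leq_trans/(_ (rank_le t)).
    by rewrite -dim_corad addn1 ltnn.
  rewrite unitmxE unitfE negbK gramE det_mulmx det_lblock det1 mul1r det_scalar.
  by rewrite expr1 mulf_eq0 (negPf t0) => /eqP.
have detE t : (\det (B {poly K} polyC 'X)).[t] = \det (B K id t).
  rewrite -horner_evalE -det_map_mx map_block_mx.
  congr (\det (block_mx _ _ _ _)); apply/matrixP => i j;
    by rewrite !mxE /= /horner_eval ?hornerE // hornerMn hornerC.
have detB0 : \det (B {poly K} polyC 'X) = 0.
  by apply: poly_vanishing_eq0 => t t0; rewrite detE det_unscaled.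
have := detE 0; rewrite detB0.
rewrite horner0 /B !scale0r addr0 det_lblock det_scalar1 map_mx_id //.
move/esym/eqP; rewrite mulf_eq0 => /orP[|/eqP //].
by have := gram_corad_unit symf; rewrite unitmxE unitfE => /negPf->.
Qed.

Lemma infinite_constant_odd_rank (r : nat) (N : {vspace bilform V}) :
  2%N \in [pchar K] -> (N <= Symm V)%VS ->
  {in N, forall f, f != 0 -> form_rank f = r} -> odd r -> (\dim N <= r)%N.
Proof.
move=> char2 /subvP symN rankN odd_r.
have [-> | N0] := eqVneq N 0%VS; first by rewrite dimv0.
set f := vpick N; have Nf : f \in N := memv_pick N.
have rankf : form_rank f = r by rewrite rankN // vpick0.
have rad0 g u : g \in N -> u \in radical f -> g u u = 0.
  move=> Ng; apply: diagonal_radical_eq0; try exact: symN.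
  move=> t; have [-> | fg0] := eqVneq (f + t *: g) 0.
    by rewrite form_rank0.
  by rewrite rankf rankN // rpredD // rpredZ.
(* The kernel of diag in N consists of alternating forms, hence is zero.      *)
pose diag (g : bilform V) :=
  \row_i g (@corad_basis _ _ f i) (@corad_basis _ _ f i).
have diag_lin : linear diag.
  move=> a g h; apply/rowP => i; rewrite !mxE.
  by rewrite add_lfunE scale_lfunE add_lfunE scale_lfunE.
pose D : {linear bilform V -> 'rV[K]_(\dim (radical f)^C)} :=
  HB.pack diag (GRing.isLinear.Build _ _ _ _ _ diag_lin).
rewrite -(limg_ker_dim (linfun D) N) (_ : (N :&: _)%VS = 0%VS) ?dimv0 ?add0n.
  rewrite (leq_trans (dimvS (subvf _))) // dimvf /dim /= mul1n.
  by rewrite dim_corad rankf.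
apply/eqP; rewrite -subv0; apply/subvP => g.
rewrite memv_cap memv_ker lfunE /= memv0.
case/andP => Ng /eqP/rowP diag0; apply: contraLR odd_r => g0.
rewrite -(rankN _ Ng g0); apply: alternating_rank_even => // [|u].
  exact: symN.
have [a [rho [rad_rho ->]]] := corad_decomp f u.
rewrite diagonalD ?symN // (rad0 _ rho) // addr0 diagonal_sum ?symN //.
rewrite big1 // => i _.
by have := diag0 i; rewrite !mxE => ->; rewrite mulr0.
Qed.

End InfiniteField.

(** * The Artin-Schreier character of a finite field *)

Section ArtinSchreier.
Variable F : finFieldType.
Hypothesis char2 : 2%N \in [pchar F].

Let addKx (a b : F) : a + (a + b) = b.
Proof. by rewrite addrA addrr_pchar2 // add0r. Qed.

Definition artin_schreier (x : F) := [exists y : F, x == y ^+ 2 + y].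

Lemma artin_schreierP x :
  reflect (exists y, x = y ^+ 2 + y) (artin_schreier x).
Proof. exact: 'exists_eqP. Qed.

Lemma artin_schreier_sqrD y : artin_schreier (y ^+ 2 + y).
Proof. by apply/artin_schreierP; exists y. Qed.

Lemma artin_schreierD x y :
  artin_schreier x -> artin_schreier y -> artin_schreier (x + y).
Proof.
move=> /artin_schreierP[a ->] /artin_schreierP[b ->].
apply/artin_schreierP; exists (a + b).
by rewrite -!(pFrobenius_autE char2) rmorphD addrACA.
Qed.

Lemma artin_schreier_fiber (x y : F) :
  x ^+ 2 + x = y ^+ 2 + y -> (x == y) || (x == y + 1).
Proof.
move=> xy; rewrite -subr_eq0 -(subr_eq0 _ (y + 1)) -mulf_eq0; apply/eqP.
have two0 : 2%:R = 0 :> F := pcharf0 char2.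
apply: (@etrans _ _ (x ^+ 2 + x - (y ^+ 2 + y)
                     - 2%:R * (x * y + x - y ^+ 2 - y))).
  by ring.
by rewrite two0 mul0r subr0 xy subrr.
Qed.

(** The fibres of y |-> y^2 + y are the pairs {y, y + 1}; comparing the ranks
    of y and y + 1 in an enumeration separates the two elements of a fibre. *)
Lemma card_artin_schreier : (#|F| <= #|artin_schreier| * 2)%N.
Proof.
have <- : #|{: {x | artin_schreier x} * bool}| = (#|artin_schreier| * 2)%N.
  by rewrite card_prod card_sig card_bool; congr (_ * _)%N; apply: eq_card.
pose below (y : F) := (enum_rank y < enum_rank (y + 1)%R)%N.
pose code (y : F) : {x | artin_schreier x} * bool :=
  (exist artin_schreier _ (artin_schreier_sqrD y), below y).
apply: (@leq_card _ _ code) => y z [/artin_schreier_fiber/orP[] /eqP // ->].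
rewrite /below -addrA addrr_pchar2 // addr0.
case: ltngtP => // /val_inj/enum_rank_inj/eqP + _.
by rewrite -subr_eq0 addrAC subrr add0r oner_eq0.
Qed.

(** The subgroup P of the elements z^2 + z and its translate x + P are disjoint,
    and each contains at least half of the field, so x + P contains y. *)
Lemma artin_schreier_index2 x y :
  ~~ artin_schreier x -> ~~ artin_schreier y -> artin_schreier (x + y).
Proof.
move=> nx ny; pose P := [set z | artin_schreier z].
have disj : P :&: +%R x @: P = set0.
  apply/setP => z; rewrite !inE; apply/negbTE/negP => /andP[az /imsetP[p]].
  rewrite inE => ap z_xp; case/negP: nx; rewrite -(addKx p x) (addrC p x) -z_xp.
  exact: artin_schreierD.
have : y \in P :|: +%R x @: P.
  suff -> : P :|: +%R x @: P = [set: F] by rewrite inE.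
  apply/eqP; rewrite eqEcard subsetT cardsT cardsU disj cards0 subn0.
  rewrite card_imset ?addnn ?cardsE -?muln2 ?card_artin_schreier //.
  exact: addrI.
rewrite inE => /orP[|/imsetP[p]]; first by rewrite inE (negPf ny).
by rewrite inE => ap ->; rewrite addKx.
Qed.

Lemma artin_schreier0 : artin_schreier 0.
Proof. by apply/artin_schreierP; exists 0; rewrite expr0n addr0. Qed.

(** The elements y^2 + y are those of absolute trace 0 (additive Hilbert 90), so
    this is the character (-1)^Tr; its kernel defines it without the trace. *)
Definition as_char (x : F) : int := if artin_schreier x then 1 else -1.

Lemma as_charD x y : as_char (x + y) = as_char x * as_char y.
Proof.
rewrite /as_char; case: (boolP (artin_schreier x)) => ax.
  rewrite mul1r; suff -> : artin_schreier (x + y) = artin_schreier y by [].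
  apply/idP/idP; last exact: artin_schreierD.
  by move=> /(artin_schreierD ax); rewrite addKx.
case: (boolP (artin_schreier y)) => ay; last by rewrite artin_schreier_index2.
rewrite mulr1; case: ifP => // axy.
by case/negP: ax; rewrite -(addKx y x) (addrC y x) artin_schreierD.
Qed.

Lemma as_char_sqrD y : as_char (y ^+ 2 + y) = 1.
Proof. by rewrite /as_char artin_schreier_sqrD. Qed.

(** The map y |-> y^2 + y takes the same value at 0 and 1, so it is not
    injective, hence not surjective. *)
Lemma exists_as_char_neg : exists x, as_char x = -1.
Proof.
pose h (y : F) := y ^+ 2 + y.
suff /existsP[x nx] : [exists x, ~~ artin_schreier x].
  by exists x; rewrite /as_char (negPf nx).
rewrite -negb_forall; apply/negP => /forallP all_as.
pose g x := xchoose (existsP (all_as x)).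
have gK : cancel g h.
  by move=> x; rewrite /h -(eqP (xchooseP (existsP (all_as x)))).
have h_inj := can_inj (canF_sym gK).
have /h_inj/eqP : h 0 = h 1 by rewrite /h expr0n add0r expr1n addrr_pchar2.
by rewrite eq_sym oner_eq0.
Qed.

Lemma char2_sqrt (x : F) : exists y, y ^+ 2 = x.
Proof.
have [g _ gK] := injF_bij (fmorph_inj (pFrobenius_aut char2)).
by exists (g x); rewrite -(pFrobenius_autE char2) gK.
Qed.

End ArtinSchreier.

Lemma sum_sign_change (T : finType) (P : pred T) (chi : T -> int) (h : T -> T) :
  injective h -> P \o h =1 P -> (forall x, chi (h x) = - chi x) ->
  \sum_(x | P x) chi x = 0.
Proof.
move=> h_inj Ph chih; set S := \sum_(x | P x) _; suff SN : S = - S by lia.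
rewrite {1}/S (reindex_inj h_inj) /= -sumrN.
by apply: eq_big => // x _; rewrite chih.
Qed.

Lemma card_finvect_vspace (F : finFieldType) (V : vectType F) (U : {vspace V}) :
  #|[pred u : finvect_type V | (u : V) \in U]| = (#|F| ^ \dim U)%N.
Proof.
(* card_vspace needs the vector space to be an explicit record.               *)
case: V U => V cV U.
exact: (@card_vspace F (finvect_type (Vector.Pack cV)) cV U).
Qed.

(** * Constant odd rank over a finite field *)

Section FiniteField.
Variables (F : finFieldType) (V : vectType F).
Hypothesis char2 : 2%N \in [pchar F].
Local Notation T := (finvect_type V).
Local Notation chi := (@as_char F).
Implicit Types (f g : bilform V).

(** The square root of the diagonal is a linear form, because a finite field is
    perfect, and it vanishes on the radical, so it is f(_, w) for some w. The
    vector w is obtained by solving this on a complement of the radical, where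
    f is nondegenerate. *)
Lemma diagonal_sqrt f :
  f \in Symm V -> exists w, forall u, f u u = (f u w) ^+ 2.
Proof.
move=> symf; have /SymmP fC := symf; pose X := @corad_basis _ _ f.
have /fin_all_exists[s sE] i := char2_sqrt char2 (f (X i) (X i)).
have [w fw] : exists w, forall i, f w (X i) = s i.
  pose b := (\row_i s i) *m invmx (gram f X).
  exists (\sum_i b 0 i *: X i) => i.
  by rewrite gram_mul mulmxKV ?gram_corad_unit // mxE.
exists w => u; have [a [rho [/radicalP rad_rho ->]]] := corad_decomp f u.
rewrite diagonalD // rad_rho addr0 diagonal_sum // -/X.
rewrite fC linearD /= (fC w rho) rad_rho addr0 linear_sum.
rewrite -(pFrobenius_autE char2) rmorph_sum; apply: eq_bigr => i _.
rewrite linearZ /= fw pFrobenius_autE.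
by rewrite -sE -exprMn.
Qed.

(** The form a(u, v) = f(u, v) + f(w, u) f(w, v) is alternating. When
    f(w, w) = 0 it has the same radical as f, so f has even rank. *)
Lemma diagonal_sqrt_isotropic f w :
  f \in Symm V -> (forall u, f u u = (f u w) ^+ 2) -> f w w = 0 ->
  ~~ odd (form_rank f).
Proof.
move=> symf fw w0; have /SymmP fC := symf.
pose sq (u : V) := f w u *: f w.
have sq_lin : linear sq.
  by move=> a x y; rewrite /sq linearP scalerDl scalerA.
pose sqL : {linear V -> 'Hom(V, F^o)} :=
  HB.pack sq (GRing.isLinear.Build _ _ _ _ _ sq_lin).
pose a := f + linfun sqL.
have aE u v : a u v = f u v + f w u * f w v.
  by rewrite /a !add_lfunE lfunE /= scale_lfunE.
have sym_a : a \in Symm V by apply/SymmP => u v; rewrite !aE fC mulrC.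
have rad_a : radical a = radical f.
  apply/vspaceP => x; apply/radicalP/radicalP => x0 v.
    have := x0 w; rewrite aE w0 mulr0 addr0 => xw0.
    by have := x0 v; rewrite aE (fC w) xw0 mul0r addr0.
  by rewrite aE (fC w) !x0 mul0r addr0.
have := alternating_rank_even char2 sym_a; rewrite /form_rank rad_a; apply => u.
by rewrite aE fw (fC w) addrr_pchar2.
Qed.

(** The value h(x, x), for x = u + z v, of the Hermitian form h extending f to
    the quadratic extension F(z), z^2 + z + d = 0. *)
Definition hermitian_form (d : F) f (u v : V) : F :=
  f u u + f u v + d * f v v.

Definition hermitian_sum d f : int :=
  \sum_(v : T) \sum_(u : T) chi (hermitian_form d f u v).

Lemma card_finvect : #|T| = (#|F| ^ \dim {:V})%N.
Proof.
by rewrite -card_finvect_vspace; apply: eq_card => u; rewrite !inE memvf.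
Qed.

(** If the linear form f(_, z) is not zero, it takes the value d at some vector
    t, and translation by t changes the sign of the summand. *)
Lemma sum_as_char_functional d f z :
  f \in Symm V -> chi d = -1 ->
  \sum_(u : T) chi (f u z) = if z \in radical f then #|T|%:R else 0.
Proof.
move=> /SymmP fC chid; case: ifPn => [/radicalP z0 | nz0].
  rewrite (eq_bigr (fun=> 1)) ?sumr_const // => u _.
  by rewrite fC z0 /as_char artin_schreier0.
have [u0 u0z] : exists u0, f u0 z != 0.
  suff /existsP[u0 u0z] : [exists u0 : T, f u0 z != 0] by exists u0.
  apply: contraR nz0; rewrite negb_exists => /forallP z0.
  by apply/radicalP => u; rewrite fC; exact/eqP/negPn/(z0 u).
pose t := (d / f u0 z) *: u0.
apply: (@sum_sign_change T xpredT _ (fun u => u + t)) => // [u v /addIr //|u].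
rewrite linearD add_lfunE as_charD //.
have -> : f t z = d by rewrite /t linearZ scale_lfunE /= -[RHS](divfK u0z).
by rewrite chid mulrN1.
Qed.

(** Let f(u, u) = f(u, w)^2 for all u. As chi(f(u, w)^2 + f(u, w)) = 1, the sum
    over u is, up to the factor chi(d f(v, v)), that of chi(f(u, v - w)), which
    is nonzero only for v in w + rad f. There f(v, v) = f(w, w)^2 = f(w, w) is
    0 or 1, and oddness of the rank excludes 0: every surviving term has the
    sign chi(d) = -1. *)
Lemma hermitian_sum_odd d f :
  chi d = -1 -> f \in Symm V -> odd (form_rank f) ->
  hermitian_sum d f = - (#|F| ^ (\dim {:V} + \dim (radical f)))%:R.
Proof.
move=> chid symf odd_f; have /SymmP fC := symf.
have [w fw] := diagonal_sqrt symf.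
have w1 : f w w = 1.
  have := fw w; rewrite expr2 -{1}[f w w]mulr1 => /mulfI ww.
  apply/esym/ww; apply: contraL odd_f => /eqP.
  exact: diagonal_sqrt_isotropic.
have inner (v : T) : \sum_(u : T) chi (hermitian_form d f u v)
    = if v - w \in radical f then - #|T|%:R else 0.
  have -> : \sum_(u : T) chi (hermitian_form d f u v)
      = chi (d * f v v) * \sum_(u : T) chi (f u (v - w)).
    rewrite mulr_sumr; apply: eq_bigr => u _.
    rewrite /hermitian_form as_charD // mulrC; congr (_ * _).
    rewrite -[RHS]mul1r -(as_char_sqrD (f u w)) -as_charD // -fw.
    by rewrite linearB /= addrA addrAC addrK.
  rewrite (sum_as_char_functional _ symf chid).
  case: ifP => [vw | _]; last by rewrite mulr0.
  suff -> : f v v = 1 by rewrite mulr1 chid mulN1r.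
  rewrite fw -(subrK w v) linearD add_lfunE (radicalP _ _ vw) add0r w1.
  by rewrite expr1n.
rewrite /hermitian_sum (eq_bigr _ (fun v _ => inner v)) -big_mkcond /=.
rewrite (reindex_inj (addIr (w : T))) /=.
rewrite (eq_bigl [pred v : T | (v : V) \in radical f]) => [|v].
  by rewrite sumr_const mulNrn -mulrnA card_finvect card_finvect_vspace expnD.
by rewrite addrK.
Qed.

Lemma hermitian_sum0 d :
  hermitian_sum d 0 = (#|F| ^ (\dim {:V} + \dim {:V}))%:R.
Proof.
rewrite /hermitian_sum (eq_bigr (fun=> #|T|%:R)) => [|v _].
  by rewrite sumr_const -mulrnA card_finvect expnD.
rewrite (eq_bigr (fun=> 1)) ?sumr_const // => u _.
by rewrite /hermitian_form !zero_lfunE mulr0 !addr0 /as_char artin_schreier0.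
Qed.

(** For fixed u and v, f |-> chi(hermitian_form d f u v) is a homomorphism from
    N to {1, -1}, whose sum over N is the order of N or 0. *)
Lemma sum_hermitian_sum_ge0 d (N : {vspace bilform V}) :
  0 <= \sum_(f : finvect_type (bilform V) | (f : bilform V) \in N)
         hermitian_sum d f.
Proof.
rewrite exchange_big /= sumr_ge0 // => v _.
rewrite exchange_big /= sumr_ge0 // => u _.
have formD f g : hermitian_form d (f + g) u v
    = hermitian_form d f u v + hermitian_form d g u v.
  by rewrite /hermitian_form !add_lfunE mulrDr (addrACA (f u u)) [LHS]addrACA.
have [/existsP[f0 /andP[Nf0 /eqP f0N]] | all1] :=
  boolP [exists f0 : finvect_type (bilform V), ((f0 : bilform V) \in N) &&
    (chi (hermitian_form d f0 u v) == -1)].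
  rewrite (@sum_sign_change (finvect_type (bilform V)) _ _ (fun f => f + f0))
    // => [f g /addIr //|f|f].
    by rewrite /= rpredDr.
  by rewrite formD as_charD // f0N mulrN1.
rewrite sumr_ge0 // => f Nf; move: all1; rewrite negb_exists => /forallP/(_ f).
by rewrite Nf /= /as_char; case: ifP.
Qed.

Lemma finite_constant_odd_rank (r : nat) (N : {vspace bilform V}) :
  (N <= Symm V)%VS ->
  {in N, forall f, f != 0 -> form_rank f = r} -> odd r -> (\dim N <= r)%N.
Proof.
move=> /subvP symN rankN odd_r; have [d chid] := exists_as_char_neg char2.
have [-> | N0] := eqVneq N 0%VS; first by rewrite dimv0.
set q := #|F|; set n := \dim {:V}.
have radE f : f \in N -> f != 0 -> (r + \dim (radical f) = n)%N.
  by move=> Nf f0; rewrite -(rankN f) // subnK // dimvS ?subvf.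
set m := \dim (radical (vpick N)).
have rm : (r + m = n)%N by rewrite radE ?memv_pick ?vpick0.
have := sum_hermitian_sum_ge0 d N.
rewrite (bigD1 (0 : finvect_type (bilform V))) /= ?[_ \in N](@mem0v _ _ N) //.
rewrite hermitian_sum0.
rewrite (eq_bigr (fun=> - (q ^ (n + m))%:R)) => [|f /andP[Nf f0]]; last first.
  rewrite hermitian_sum_odd ?rankN ?symN // -/q -/n; congr (- (_ ^ (_ + _))%:R).
  by apply/eqP; rewrite -(eqn_add2l r) radE ?rm.
rewrite sumr_const mulNrn -mulrnA subr_ge0 ler_nat.
have q_gt1 : (1 < q)%N := finNzRing_gt1 F.
have -> : #|[pred f : finvect_type (bilform V)
             | ((f : bilform V) \in N) && (f != 0)]| = (q ^ \dim N).-1.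
  rewrite -card_finvect_vspace [in RHS](cardD1 (0 : finvect_type (bilform V))).
  by rewrite inE (@mem0v _ _ N) add1n; apply: eq_card => f; rewrite !inE andbC.
have -> : (q ^ (n + n) = q ^ (n + m) * q ^ r)%N.
  by rewrite -expnD -addnA (addnC m) rm.
rewrite leq_pmul2l ?expn_gt0 ?(ltnW q_gt1) // => qd.
rewrite -ltnS -(ltn_exp2l _ _ q_gt1).
have qr : (2 <= q ^ r)%N.
  case: (r) odd_r => // k _; rewrite expnS (leq_trans q_gt1) // leq_pmulr //.
  by rewrite expn_gt0 ltnW.
have : (2 * q ^ r <= q ^ r.+1)%N by rewrite expnS leq_mul2r q_gt1 orbT.
have : (0 < q ^ \dim N)%N by rewrite expn_gt0 ltnW.
move: qd qr; move: (q ^ r)%N (q ^ r.+1)%N (q ^ \dim N)%N => a b c; lia.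
Qed.

End FiniteField.

(** * The dimension bound *)

(** Reduces a statement about a field that happens to have finitely many
    elements to one about finFieldType, whose counting lemmas apply. *)
Lemma finite_field_ind (P : fieldType -> Prop) (K : fieldType) (s : seq K) :
  (forall F : finFieldType, P F) -> (forall x : K, x \in s) -> P K.
Proof.
(* Once K is an explicit record, forgetting the finiteness of F gives back K  *)
(* by conversion, with the same field operations.                             *)
case: K s => K [? ? ? ? ? ? ? ? ? ? ? ? ? ? ?] s PF.
set k := GRing.Field.Pack _ in s |- * => sK.
have indexK : pcancel (fun x : k => index x s) (fun i => Some (nth 0 s i)).
  by move=> x; rewrite nth_index.
have enumK : Finite.axiom (undup s).
  by move=> x; rewrite count_uniq_mem ?undup_uniq // mem_undup sK.
pose countK := PCanIsCountable indexK; pose finK := isFinite.Build k enumK.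
pose F : finFieldType := HB.pack k countK finK.
exact: (PF F).
Qed.

Lemma constant_odd_rank_dim_le (K : fieldType) (V : vectType K) (r : nat)
    (N : {vspace bilform V}) :
  2%N \in [pchar K] -> (N <= Symm V)%VS ->
  {in N, forall f, f != 0 -> form_rank f = r} -> odd r -> (\dim N <= r)%N.
Proof.
have [[s sK] | infK] := classic (exists s : seq K, forall x, x \in s).
  move=> char2; move: V N char2.
  apply: (@finite_field_ind (fun K => forall (V : vectType K)
    (N : {vspace bilform V}), 2%N \in [pchar K] -> (N <= Symm V)%VS ->
    {in N, forall f, f != 0 -> form_rank f = r} -> odd r ->
    (\dim N <= r)%N) K s) => // F V N char2.
  move=> NS rN odd_r.
  exact: (@finite_constant_odd_rank F V char2 r N NS rN odd_r).
apply: infinite_constant_odd_rank => s.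
have [//|no_x] := classic (exists x, x \notin s).
case: infK; exists s => x; apply/negPn/negP => x_s.
by apply: no_x; exists x.
Qed.

Theorem theorem5 (K : fieldType) (V : vectType K) (n r : nat)
    (M : {vspace bilform V}) :
  2%N \in [pchar K] ->
  \dim {:V} = n ->
  (M <= Symm V)%VS ->
  {in M, forall f, f != 0 -> form_rank f = r \/ form_rank f = n} ->
  (0 < r < n)%N -> odd r -> ~~ odd n ->
  (\dim M <= n + r)%N.
Proof.
move=> char2 dimV symM rankM /andP[r_gt0 r_lt_n] odd_r _.
pose u := vpick {:V}.
have u0 : u != 0 by rewrite vpick0 -dimv_eq0 dimV -lt0n (ltn_trans r_gt0).
have eval_lin : linear (fun f : bilform V => f u).
  by move=> a f g; rewrite add_lfunE scale_lfunE.
pose eval : {linear bilform V -> 'Hom(V, K^o)} :=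
  HB.pack (fun f : bilform V => f u) (GRing.isLinear.Build _ _ _ _ _ eval_lin).
rewrite -(limg_ker_dim (linfun eval) M) addnC leq_add //.
  rewrite (leq_trans (dimvS (subvf _))) // dimvf /dim /= muln1.
  by rewrite -dimV dimvf.
apply: constant_odd_rank_dim_le => // [|f].
  exact: subv_trans (capvSl _ _) symM.
rewrite memv_cap memv_ker lfunE /= => /andP[Mf /eqP fu0] f0.
case: (rankM f Mf f0) => // rank_n.
suff : u \in 0%VS by rewrite memv0 (negPf u0).
suff <- : radical f = 0%VS by rewrite memv_ker fu0.
apply/eqP; rewrite -dimv_eq0; move: rank_n; rewrite /form_rank dimV.
have := dimvS (subvf (radical f)); rewrite dimV; lia.
Qed.
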